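(* Let $m\ge 2$ and let $p_j\in\mathbb{R}^2$, $j=1,\ldots,m$, be pairwise distinct points. Let $f:\mathbb{R}\times S^1\to\mathbb{R}$, $f(c,n)=\max_{j=1,\ldots,m}|\langle p_j,n\rangle-c|$. There exists a line with minimal geometric $L^\infty$-distance to the set $\{p_1,\ldots,p_m\}$. If $0<f(c_0,n_0)=\min\{f(c,n):c\in\mathbb{R},n\in S^1\}$, then there exist pairwise distinct indices $k_1,k_2,k_3$ with $p_{k_1},p_{k_2},p_{k_3}\in V$ such that $f(c_0,n_0)=|\langle p_{k_i},n_0\rangle-c_0|$ for $i=1,2,3$ and $S_{k_1k_2}\subset\partial P$. Moreover, $$\min_{c\in\mathbb{R},\,n\in S^1}f(c,n)=\min_{c\in\mathbb{R},\,n\in S^1}\max_{j=1,\ldots,m}|\langle p_j,n\rangle-c|=\min_{c\in\mathbb{R},\,n\in S^1}\max_{p_j\in V}|\langle p_j,n\rangle-c|=\frac12\min_{S_{kl}\subset\partial P}\ \max_{p_j\in V}\frac{|\langle p_j-p_k,J(p_l-p_k)\rangle|}{\|p_l-p_k\|}.$$ In particular, the set of optimal lines (lines with minimal geometric $L^\infty$-distance to $\{p_1,\ldots,p_m\}$) is finite.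
   Context: A line $\{q\in\mathbb{R}^2:\langle q,n\rangle=c\}$ with $c\in\mathbb{R}$, $n\in S^1$ (unit circle) has minimal geometric $L^\infty$-distance to $\{p_1,\ldots,p_m\}$ if $f$ attains its global minimum over $\mathbb{R}\times S^1$ at $(c,n)$. $J=\begin{pmatrix}0&-1\\1&0\end{pmatrix}$. $P$ denotes the convex hull of $\{p_1,\ldots,p_m\}$ (smallest convex set containing these points) and $\partial P$ its topological boundary in $\mathbb{R}^2$. $V$ is the set of vertices of $P$: $V=\{p_k : p_k\text{ is not in the convex hull of }\{p_j:j\neq k\}\}$. For $k\neq l$ with $p_k,p_l\in V$, $S_{kl}=\{p_l+t(p_k-p_l):0\le t\le1\}$. The minimum over $S_{kl}\subset\partial P$ is taken over all pairs $k\neq l$ with $p_k,p_l\in V$ and $S_{kl}\subset\partial P$. *)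

(* Defs.v *)
From HB Require Import structures.
From mathcomp Require Import all_boot all_order all_algebra.
From mathcomp Require Import all_classical all_reals all_analysis.
Set Implicit Arguments.
Unset Strict Implicit.
Unset Printing Implicit Defensive.
Import Order.TTheory GRing.Theory Num.Theory.
Import numFieldTopology.Exports numFieldNormedType.Exports.
Local Open Scope classical_set_scope.
Local Open Scope ring_scope.

Section Plane.
Context {R : realType}.
Implicit Types (u v n : 'cV[R]_2) (c : R).

Definition dot u v : R := \sum_i u i 0 * v i 0.

(* The Euclidean norm; the library norm `|u| on matrices is the sup norm,
   which is used here only through the topology it induces. *)
Definition enorm u : R := Num.sqrt (dot u u).

Definition unit_circle : set 'cV[R]_2 := [set n | enorm n = 1].

(* Rotation by a right angle, with rows (0, -1) and (1, 0). *)
Definition J : 'M[R]_2 := delta_mx 1 0 - delta_mx 0 1.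

Definition line c n : set 'cV[R]_2 := [set q | dot q n = c].

Definition convex_hull (A : set 'cV[R]_2) : set 'cV[R]_2 :=
  smallest (@convex_set R 'cV[R]_2) A.

Definition boundary (A : set 'cV[R]_2) : set 'cV[R]_2 :=
  closure A `\` interior A.

Definition is_minimum (A : set R) (x : R) : Prop := A x /\ lbound A x.

End Plane.

Section PointSet.
Context {R : realType} {m : nat}.
Context (p : 'I_m -> 'cV[R]_2).

(* In the maxima below all terms are nonnegative, so the default value 0 of the
   iterated maximum only matters for an empty range. *)
Definition maxdist (c : R) (n : 'cV[R]_2) : R :=
  \big[Num.max/0]_(j < m) `|dot (p j) n - c|.

(* maxdist attains its global minimum over R x S^1 at (c, n) *)
Definition optimal (c : R) (n : 'cV[R]_2) : Prop :=
  unit_circle n /\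
  forall (c' : R) (n' : 'cV[R]_2), unit_circle n' ->
    maxdist c n <= maxdist c' n'.

Definition optimal_lines : set (set 'cV[R]_2) :=
  [set L | exists c n, optimal c n /\ L = line c n].

Definition hull : set 'cV[R]_2 := convex_hull (range p).

Definition vertices : set 'cV[R]_2 :=
  [set p k | k in [set k | ~ convex_hull (p @` [set j | j != k]) (p k)]].

Definition maxdist_vertices (c : R) (n : 'cV[R]_2) : R :=
  \big[Num.max/0]_(j < m | p j \in vertices) `|dot (p j) n - c|.

Definition segment (k l : 'I_m) : set 'cV[R]_2 :=
  [set p l + t *: (p k - p l) | t in [set t : R | 0 <= t <= 1]].

Definition boundary_edge (k l : 'I_m) : Prop :=
  [/\ k != l, vertices (p k), vertices (p l) &
      segment k l `<=` boundary hull].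

Definition edge_width (k l : 'I_m) : R :=
  \big[Num.max/0]_(j < m | p j \in vertices)
    (`|dot (p j - p k) (J *m (p l - p k))| / enorm (p l - p k)).

End PointSet.

(* Main.v *)
Require Import Defs.
From HB Require Import structures.
From mathcomp Require Import all_boot all_order all_algebra.
From mathcomp Require Import all_classical all_reals all_analysis.
From mathcomp Require Import ring lra.
Set Implicit Arguments.
Unset Strict Implicit.
Unset Printing Implicit Defensive.
Import Order.TTheory GRing.Theory Num.Theory.
Import numFieldTopology.Exports numFieldNormedType.Exports.
Local Open Scope classical_set_scope.
Local Open Scope ring_scope.

(** For a unit normal [n] the points project onto an interval whose ends
    [dot (p b) n <= dot (p a) n] are attained on the two faces of the hull exposed
    by [n] and [- n]. The deviation is then
    [maxdist p c n = Num.max (dot (p a) n - c) (c - dot (p b) n)]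
    ([maxdist_face]), so for fixed [n] the best offset is the midpoint and the
    deviation there is half the width of the point set in direction [n]. Everything
    thus reduces to minimizing the width over the circle; the minimum exists by
    compactness ([exists_spread_min]).

    The heart is [singleton_faces_width0]: if, at a minimizing [n], both exposed
    faces were single points [p a] and [p b], then [n] could be turned slightly
    towards whichever side does not increase [dot (p a - p b) _]. The same two
    points stay extremal during a small turn, and after renormalization the width
    has shrunk strictly unless it was already zero. Hence one of the faces contains
    two points ([optimal_face]); the lexicographically extreme points of a face are
    vertices ([lex_max_vertex]), so the face contains two vertices, the segment
    between them lies on the boundary because the whole hull lies on one side of it
    ([face_segment_boundary]), and any vertex of the opposite face is the third
    contact point ([optimal_three]).

    Conversely, the line through two vertices joined by a segment in the boundary
    supports the hull ([boundary_edge_one_sided]), so [edge_width] of such a pair is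
    a width of the point set, hence at least twice the minimal deviation, with
    equality for the edge found above. Finiteness follows because an optimal normal
    is perpendicular to a difference of two of the points and the offset is then the
    forced midpoint. *)

(** * Coordinates, rotation and the dot product *)

Section Plane.
Context {R : realType}.
Implicit Types (u v w n : 'cV[R]_2).

Lemma dotE u v : dot u v = u 0 0 * v 0 0 + u 1 0 * v 1 0.
Proof.
rewrite /dot !big_ord_recl big_ord0 addr0.
by rewrite (_ : lift _ _ = 1)//; exact: val_inj.
Qed.

Lemma J_fst v : (J *m v) 0 0 = - v 1 0.
Proof.
rewrite mxE !big_ord_recl big_ord0 !mxE /= (_ : lift _ _ = 1); last exact: val_inj.
by ring.
Qed.

Lemma J_snd v : (J *m v) 1 0 = v 0 0.
Proof.
rewrite mxE !big_ord_recl big_ord0 !mxE /= (_ : lift _ _ = 1); last exact: val_inj.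
by ring.
Qed.

Lemma colvec2_eq u v : u 0 0 = v 0 0 -> u 1 0 = v 1 0 -> u = v.
Proof.
move=> e0 e1; apply/matrixP => i j; rewrite ord1.
case: i => [[|[|//]] hi]; [have -> : Ordinal hi = 0|have -> : Ordinal hi = 1] => //;
  exact: val_inj.
Qed.

Lemma dotC u v : dot u v = dot v u.
Proof. by rewrite !dotE mulrC [X in _ + X]mulrC. Qed.

Lemma dotDl u v w : dot (u + v) w = dot u w + dot v w.
Proof. by rewrite !dotE !mxE; ring. Qed.

Lemma dotNl u v : dot (- u) v = - dot u v.
Proof. by rewrite !dotE !mxE; ring. Qed.

Lemma dotBl u v w : dot (u - v) w = dot u w - dot v w.
Proof. by rewrite dotDl dotNl. Qed.

Lemma dotZl r u v : dot (r *: u) v = r * dot u v.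
Proof. by rewrite !dotE !mxE; ring. Qed.

Lemma dotDr u v w : dot w (u + v) = dot w u + dot w v.
Proof. by rewrite !(dotC w) dotDl. Qed.

Lemma dotNr u v : dot v (- u) = - dot v u.
Proof. by rewrite !(dotC v) dotNl. Qed.

Lemma dotZr r u v : dot v (r *: u) = r * dot v u.
Proof. by rewrite !(dotC v) dotZl. Qed.

Lemma dotJJ u v : dot (J *m u) (J *m v) = dot u v.
Proof. by rewrite !dotE !J_fst !J_snd; ring. Qed.

Lemma dotvJv v : dot v (J *m v) = 0.
Proof. by rewrite !dotE !J_fst !J_snd; ring. Qed.

Lemma dotvv_ge0 v : 0 <= dot v v.
Proof. by rewrite dotE -!expr2 addr_ge0 ?sqr_ge0. Qed.

Lemma dotvv_eq0 v : (dot v v == 0) = (v == 0).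
Proof.
apply/eqP/eqP => [|->]; last by rewrite dotE !mxE !mul0r addr0.
rewrite dotE -!expr2 => /eqP; rewrite paddr_eq0 ?sqr_ge0// !sqrf_eq0.
by move=> /andP[/eqP v0 /eqP v1]; apply: colvec2_eq; rewrite mxE.
Qed.

Lemma dotvv_gt0 v : v != 0 -> 0 < dot v v.
Proof. by rewrite lt_def dotvv_ge0 dotvv_eq0 andbT. Qed.

Lemma enorm_gt0 v : v != 0 -> 0 < enorm v.
Proof. by move=> v0; rewrite sqrtr_gt0 dotvv_gt0. Qed.

Lemma unit_circleE n : unit_circle n <-> dot n n = 1.
Proof.
split => [|n1]; last by rewrite /unit_circle /= /enorm n1 sqrtr1.
rewrite /unit_circle /= /enorm => n1.
by rewrite -(sqr_sqrtr (dotvv_ge0 n)) n1 expr1n.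
Qed.

Lemma unit_neq0 n : unit_circle n -> n != 0.
Proof. by move=> /unit_circleE n1; rewrite -dotvv_eq0 n1 oner_eq0. Qed.

Lemma unit_circleN n : unit_circle n -> unit_circle (- n).
Proof. by rewrite !unit_circleE dotNl dotNr opprK. Qed.

Lemma unit_normalize v : v != 0 -> unit_circle ((enorm v)^-1 *: v).
Proof.
move=> v0; apply/unit_circleE; rewrite dotZl dotZr -(sqr_sqrtr (dotvv_ge0 v)).
rewrite -/(enorm v) expr2; have := enorm_gt0 v0.
by rewrite lt0r => /andP[? _]; field.
Qed.

Lemma J_eq0 v : (J *m v == 0) = (v == 0).
Proof. by rewrite -!dotvv_eq0 dotJJ. Qed.

Lemma enormJ v : enorm (J *m v) = enorm v.
Proof. by rewrite /enorm dotJJ. Qed.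

(** A nonzero vector and its rotation form an orthogonal basis, so the two
    coordinates in that basis determine a point. *)
Lemma dot_basis_eq n u v : n != 0 ->
  dot u n = dot v n -> dot u (J *m n) = dot v (J *m n) -> u = v.
Proof.
move=> n0 e1 e2; apply/eqP; rewrite -subr_eq0 -dotvv_eq0; apply/eqP.
set w := u - v.
have wn : dot w n = 0 by rewrite dotBl e1 subrr.
have wJ : dot w (J *m n) = 0 by rewrite dotBl e2 subrr.
have : dot w w * dot n n = 0.
  have -> : dot w w * dot n n = dot w n ^+ 2 + dot w (J *m n) ^+ 2.
    by rewrite !dotE !J_fst !J_snd; ring.
  by rewrite wn wJ expr0n addr0.
by move=> /eqP; rewrite mulf_eq0 (dotvv_eq0 n) (negbTE n0) orbF => /eqP.
Qed.

(** In the plane the direction perpendicular to [v] is unique up to sign. *)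
Lemma normal_unit n v : unit_circle n -> dot v n = 0 ->
  J *m v = enorm v *: n \/ J *m v = - (enorm v *: n).
Proof.
move=> n1 vn; have nn := (unit_circleE n).1 n1.
have Jv : J *m v = dot (J *m v) n *: n.
  apply: (dot_basis_eq (unit_neq0 n1)); first by rewrite dotZl nn mulr1.
  by rewrite dotJJ vn dotZl dotvJv mulr0.
have en : enorm v = `|dot (J *m v) n|.
  by rewrite -enormJ {1}Jv /enorm dotZl dotZr nn mulr1 -expr2 sqrtr_sqr.
have [r0|r0] := leP 0 (dot (J *m v) n).
- by left; rewrite {1}Jv en ger0_norm.
- by right; rewrite {1}Jv en ltr0_norm// scaleNr opprK.
Qed.

End Plane.

(** * Convex hulls and interior points *)

Section Convexity.
Context {R : realType}.
Implicit Types (u v n d x y : 'cV[R]_2) (A B : set 'cV[R]_2).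

(** Restates convexity with an ordinary real weight instead of a bundled element of
    the unit interval. *)
Lemma convex_setP A : convex_set A <->
  forall x y (t : R), A x -> A y -> 0 <= t -> t <= 1 ->
  A (t *: x + (1 - t) *: y).
Proof.
split=> [cA x y t Ax Ay t0 t1|cA x y t].
- have := cA x y (Itv01 t0 t1); rewrite !inE; exact.
- by rewrite !inE => Ax Ay; apply: cA.
Qed.

Lemma convex_hullP A : convex_set (convex_hull A).
Proof.
apply/convex_setP => x y t hx hy t0 t1 B [cB AB].
by apply: (convex_setP B).1 => //; [apply: hx|apply: hy].
Qed.

Lemma sub_convex_hull A : A `<=` convex_hull A.
Proof. exact: sub_gen_smallest. Qed.

Lemma convex_hull_min A B : convex_set B -> A `<=` B -> convex_hull A `<=` B.
Proof. exact: smallest_sub. Qed.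

Lemma convex_halfplane n (M : R) : convex_set [set q | dot q n <= M].
Proof.
apply/convex_setP => x y t /= xM yM t0 t1; rewrite dotDl !dotZl; nra.
Qed.

(** The points lexicographically below a given one, with respect to the pair of
    directions [(n, d)], form a half-plane completed by half of its boundary line.
    Such sets separate a lexicographic maximum from the other points. *)
Lemma convex_lex_halfplane n d (M N : R) :
  convex_set [set q | dot q n < M \/ dot q n = M /\ dot q d < N].
Proof.
apply/convex_setP => x y t /= hx hy; rewrite !dotDl !dotZl.
rewrite le_eqVlt => /predU1P[<- _|t0].
  by rewrite !mul0r !add0r subr0 !mul1r.
rewrite le_eqVlt => /predU1P[->|t1].
  by rewrite subrr !mul0r !addr0 !mul1r.
case: hx => [hx|[hx hx']]; case: hy => [hy|[hy hy']]; try (left; nra).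
right; rewrite hx hy; split; [ring|nra].
Qed.

(** The topology on column vectors is that of the sup norm. *)
Lemma nbhs_colvec2 x A : nbhs x A <-> exists2 e : R, 0 < e &
  forall y, `|x 0 0 - y 0 0| < e -> `|x 1 0 - y 1 0| < e -> A y.
Proof.
split=> [/nbhs_ballP[e /= e0 eA]|[e e0 eA]].
- exists e => // y y0 y1; apply: eA; split=> // i j; rewrite ord1.
  case: i => [[|[|//]] hi];
    [have -> : Ordinal hi = 0|have -> : Ordinal hi = 1] => //; exact: val_inj.
- apply/nbhs_ballP; exists e => //= y [_ xy]; apply: eA; exact: xy.
Qed.

Lemma convex_line A x u (s t r : R) : convex_set A -> 0 < s -> 0 < t ->
  A (x + s *: u) -> A (x - t *: u) -> - t <= r -> r <= s -> A (x + r *: u).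
Proof.
move=> /convex_setP cA s0 t0 As At tr rs.
have st : s + t != 0 by rewrite gt_eqF// addr_gt0.
suff -> : x + r *: u = ((r + t) / (s + t)) *: (x + s *: u)
    + (1 - (r + t) / (s + t)) *: (x - t *: u).
  apply: cA => //; first by rewrite divr_ge0//; lra.
  by rewrite ler_pdivrMr; lra.
by apply: colvec2_eq; rewrite !mxE; field.
Qed.

(** A point that is inner to two segments of [A] in independent directions [u] and
    [v] is interior to [A]: any small displacement is [a *: u + b *: v] with [a] and
    [b] small, and the displaced point is the midpoint of the points displaced by
    [2 * a] along [u] and by [2 * b] along [v], which lie on the two segments.
    Independence is expressed by [dot u (J *m v)], which up to sign is the
    determinant of [u] and [v]. *)
Lemma cross_interior A x u v (s s' t t' : R) : convex_set A ->
  dot u (J *m v) != 0 -> 0 < s -> 0 < s' -> 0 < t -> 0 < t' ->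
  A (x + s *: u) -> A (x - s' *: u) -> A (x + t *: v) -> A (x - t' *: v) ->
  interior A x.
Proof.
move=> cA D0 s0 s'0 t0 t'0 As As' At At'.
have Dp : 0 < `|dot u (J *m v)| by rewrite normr_gt0.
pose d := Num.min (Num.min s s') (Num.min t t').
have d0 : 0 < d by rewrite !lt_min s0 s'0 t0 t'0.
pose C : R := 1 + `|u 0 0| + `|u 1 0| + `|v 0 0| + `|v 1 0|.
have C1 : 1 <= C.
  by rewrite /C -!addrA lerDl !addr_ge0.
have C0 : 0 < C := lt_le_trans ltr01 C1.
apply/nbhs_colvec2; exists (d * `|dot u (J *m v)| / (2 * C)).
  by rewrite divr_gt0 ?mulr_gt0.
set e := _ / _ => y y0 y1.
pose w : 'cV[R]_2 := y - x.
have w0 : `|w 0 0| <= e by rewrite !mxE distrC ltW.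
have w1 : `|w 1 0| <= e by rewrite !mxE distrC ltW.
(* Cramer's rule for [w = a *: u + b *: v] *)
pose a : R := dot w (J *m v) / dot u (J *m v).
pose b : R := - dot w (J *m u) / dot u (J *m v).
have e0 : 0 <= e := le_trans (normr_ge0 _) w0.
have bnd (z : 'cV[R]_2) : `|z 0 0| + `|z 1 0| <= C -> `|dot w (J *m z)| <= e * C.
  move=> zC; rewrite dotE J_fst J_snd.
  apply: (le_trans (ler_normD _ _)); rewrite !normrM normrN.
  apply: (@le_trans _ _ (e * (`|z 0 0| + `|z 1 0|))); last by rewrite ler_wpM2l.
  by rewrite mulrDr addrC lerD// ler_wpM2r.
have eC : e * C / `|dot u (J *m v)| = d / 2.
  have Cn : C != 0 by rewrite gt_eqF.
  have Dn : `|dot u (J *m v)| != 0 by rewrite gt_eqF.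
  by rewrite /e; field; rewrite Cn Dn.
have uC : `|u 0 0| + `|u 1 0| <= C.
  by rewrite /C; have := normr_ge0 (v 0 0); have := normr_ge0 (v 1 0); lra.
have vC : `|v 0 0| + `|v 1 0| <= C.
  by rewrite /C; have := normr_ge0 (u 0 0); have := normr_ge0 (u 1 0); lra.
have ad : `|2 * a| <= d.
  rewrite normrM /a normrM normfV ger0_norm//.
  suff : `|dot w (J *m v)| / `|dot u (J *m v)| <= d / 2 by lra.
  by rewrite -eC ler_wpM2r ?invr_ge0// bnd.
have bd : `|2 * b| <= d.
  rewrite normrM /b normrM normrN normfV ger0_norm//.
  suff : `|dot w (J *m u)| / `|dot u (J *m v)| <= d / 2 by lra.
  by rewrite -eC ler_wpM2r ?invr_ge0// bnd.
have -> : y = 2^-1 *: (x + (2 * a) *: u) + (1 - 2^-1) *: (x + (2 * b) *: v).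
  have [E0 E1] : w 0 0 = a * u 0 0 + b * v 0 0 /\ w 1 0 = a * u 1 0 + b * v 1 0.
    rewrite /a /b; move: D0; rewrite !dotE !J_fst !J_snd => D0.
    by split; field.
  move: E0 E1; rewrite /w !mxE => /eqP; rewrite subr_eq => /eqP E0.
  move=> /eqP; rewrite subr_eq => /eqP E1.
  by apply: colvec2_eq; rewrite !mxE ?E0 ?E1; field.
move: ad bd; rewrite !ler_norml => /andP[a1 a2] /andP[b1 b2].
have [ds ds' dt dt'] : [/\ d <= s, d <= s', d <= t & d <= t'].
  by split; rewrite /d !ge_min lexx ?orbT.
apply: (convex_setP A).1 => //; try lra.
- by apply: (convex_line cA s0 s'0) => //; lra.
- by apply: (convex_line cA t0 t'0) => //; lra.
Qed.

End Convexity.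

(** * Exposed faces and vertices *)

Section Faces.
Context {R : realType} {m : nat} (p : 'I_m -> 'cV[R]_2).
Implicit Types (n d : 'cV[R]_2) (c : R) (i j k l a b : 'I_m).

(** The face of the hull exposed by the direction [n], seen as a set of indices; the
    points minimizing [dot _ n] form [in_face (- n)]. *)
Definition in_face n k : Prop := forall j, dot (p j) n <= dot (p k) n.

Lemma in_face_oppP n b :
  in_face (- n) b <-> forall j, dot (p b) n <= dot (p j) n.
Proof. by split=> h j; have := h j; rewrite !dotNr lerN2. Qed.

Lemma in_faceZ (r : R) n k : 0 < r -> in_face (r *: n) k <-> in_face n k.
Proof.
by move=> r0; split=> h j; have := h j; rewrite !dotZr ler_pM2l.
Qed.

Lemma in_face_eq n k l : in_face n k -> in_face n l -> dot (p k) n = dot (p l) n.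
Proof. by move=> hk hl; apply/eqP; rewrite eq_le hk hl. Qed.

Lemma in_face_transfer n k l :
  in_face n k -> dot (p l) n = dot (p k) n -> in_face n l.
Proof. by move=> hk e j; rewrite e. Qed.

Lemma exists_in_face (i0 : 'I_m) n : exists k, in_face n k.
Proof.
case: (@arg_maxP _ _ _ i0 xpredT (fun j => dot (p j) n)) => // k _ hk.
by exists k => j; apply: hk.
Qed.

(** Ties within a face are broken by a second direction [d]. *)
Lemma exists_lex_max (i0 : 'I_m) n d :
  exists2 k, in_face n k & forall j, in_face n j -> dot (p j) d <= dot (p k) d.
Proof.
have [k0 /asboolP hk0] := exists_in_face i0 n.
case: (@arg_maxP _ _ _ k0 (fun j => `[< in_face n j >]) (fun j => dot (p j) d))
  => // k /asboolP hk kmax.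
by exists k => // j /asboolP; apply: kmax.
Qed.

Lemma hull_le n k : in_face n k -> hull p `<=` [set q | dot q n <= dot (p k) n].
Proof.
move=> hk; apply: convex_hull_min; first exact: convex_halfplane.
by move=> _ [j _ <-]; apply: hk.
Qed.

(** All other points are strictly below [p k] in the lexicographic order given by
    [n] and [d], because equality in both directions would force equality of points;
    so they, and hence their hull, lie in a convex set that misses [p k]. *)
Lemma lex_max_vertex n k : injective p -> n != 0 -> in_face n k ->
  forall d, d = J *m n \/ d = - (J *m n) ->
  (forall j, in_face n j -> dot (p j) d <= dot (p k) d) ->
  vertices p (p k).
Proof.
move=> pinj n0 hk d dE kmax; exists k => //= kin.
have := convex_hull_min (@convex_lex_halfplane R n d (dot (p k) n)
  (dot (p k) d)) _ kin.
case; last 2 first.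
- by rewrite ltxx.
- by case=> _; rewrite ltxx.
- move=> _ [j /= jk <-] /=.
  have [jn|jn] := eqVneq (dot (p j) n) (dot (p k) n); last first.
    by left; rewrite lt_neqAle jn hk.
  right; split=> //; rewrite lt_neqAle kmax ?andbT; last first.
    exact: in_face_transfer hk jn.
  apply: contra jk => /eqP jd; apply/eqP/pinj/(dot_basis_eq n0) => //.
  by case: dE jd => ->// ; rewrite !dotNr => /oppr_inj.
Qed.

Lemma exists_vertex_in_face (i0 : 'I_m) n : injective p -> n != 0 ->
  exists2 k, in_face n k & vertices p (p k).
Proof.
move=> pinj n0; have [k hk kmax] := exists_lex_max i0 n (J *m n).
by exists k => //; apply: (lex_max_vertex pinj n0 hk) kmax; left.
Qed.

(** The two ends of a face, namely its extreme points in the directions [J *m n] and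
    [- (J *m n)], are vertices. They coincide only if the face is a single point. *)
Lemma exists_vertices_in_face n k l : injective p -> n != 0 ->
  k != l -> in_face n k -> in_face n l ->
  exists k' l', [/\ k' != l', in_face n k' /\ in_face n l',
    vertices p (p k') & vertices p (p l')].
Proof.
move=> pinj n0 kl hk hl.
have [a ha amax] := exists_lex_max k n (J *m n).
have [b hb bmax] := exists_lex_max k n (- (J *m n)).
exists a, b; split=> //; last 2 first.
- by apply: (lex_max_vertex pinj n0 ha) amax; left.
- by apply: (lex_max_vertex pinj n0 hb) bmax; right.
apply: contra kl => /eqP ab; subst b.
have same j : in_face n j -> p j = p a.
  move=> hj; apply: (dot_basis_eq n0); first exact: in_face_eq.
  by apply/eqP; rewrite eq_le amax//= -lerN2 -!dotNr bmax.
by apply/eqP/pinj; rewrite !same.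
Qed.

(** Moving from a point of the face outwards along [n] leaves the hull immediately,
    so no point of the face is interior. *)
Lemma face_segment_boundary n k l : n != 0 -> in_face n k -> in_face n l ->
  segment p k l `<=` boundary (hull p).
Proof.
move=> n0 hk hl _ [t /= /andP[t0 t1] <-]; set q := _ + _.
have qE : q = t *: p k + (1 - t) *: p l.
  by apply: colvec2_eq; rewrite !mxE; ring.
have ph j : hull p (p j) by apply: sub_convex_hull; exists j.
split.
  apply: subset_closure; rewrite qE.
  by apply: (convex_setP _).1 => //; exact: convex_hullP.
move=> /nbhs_colvec2[e e0 eh].
pose C : R := 1 + `|n 0 0| + `|n 1 0|.
have C0 : 0 < C by rewrite /C -addrA ltr_pwDl// addr_ge0.
have coord (i : 'I_2) : `|n i 0| < C -> `|q i 0 - (q + (e / C) *: n) i 0| < e.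
  move=> nC; rewrite !mxE opprD addrA subrr sub0r normrN normrM.
  by rewrite gtr0_norm ?divr_gt0// mulrAC ltr_pdivrMr// ltr_pM2l.
have n0C : `|n 0 0| < C.
  by rewrite /C; have := normr_ge0 (n 1 0); lra.
have n1C : `|n 1 0| < C.
  by rewrite /C; have := normr_ge0 (n 0 0); lra.
have /(hull_le hk) /= := eh _ (coord 0 n0C) (coord 1 n1C).
have -> : dot (q + (e / C) *: n) n = dot (p k) n + e / C * dot n n.
  by rewrite dotDl dotZl qE dotDl !dotZl (in_face_eq hk hl); ring.
by rewrite gerDl leNgt mulr_gt0 ?divr_gt0 ?dotvv_gt0.
Qed.

(** Suppose points [p a] and [p b] lay strictly on opposite sides of the line through
    the vertices [p k] and [p l], and let [x] be the point where their segment
    crosses it. If [x] is inner to the segment between [p k] and [p l], then two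
    segments of the hull cross at [x], which is thus interior and not on the
    boundary. Otherwise the nearer of [p k] and [p l] lies between [x] and the
    other, so it is a convex combination of other points and not a vertex. *)
Lemma boundary_edge_one_sided k l (n := J *m (p l - p k)) : injective p ->
  boundary_edge p k l -> in_face n k \/ in_face (- n) k.
Proof.
move=> pinj [kl Vk Vl Skl]; apply: contrapT => /not_orP[].
move=> /existsNP[a /negP]; rewrite -ltNge => an.
move=> /existsNP[b /negP]; rewrite -ltNge !dotNr ltrN2 => bn.
have v0 : p l - p k != 0.
  by rewrite subr_eq0; apply: contra kl => /eqP/pinj->.
have vv0 := dotvv_gt0 v0.
have lkn : dot (p l) n = dot (p k) n.
  by apply/eqP; rewrite -subr_eq0 -dotBl dotvJv.
have nvertex i : vertices p (p i) ->
    ~ convex_hull (p @` [set j | j != i]) (p i).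
  by move=> [i' hi' /pinj <-].
have others i : dot (p i) n = dot (p k) n -> forall j, j = a \/ j = b ->
    convex_hull (p @` [set j | j != i]) (p j).
  move=> ik j jab; apply: sub_convex_hull; exists j => //=.
  apply/eqP => ji; subst i.
  by case: jab => ?; subst j; move: an bn; rewrite ik ltxx.
pose al : R := dot (p a) n - dot (p k) n.
pose be : R := dot (p k) n - dot (p b) n.
have al0 : 0 < al by rewrite subr_gt0.
have be0 : 0 < be by rewrite subr_gt0.
(* the weight of [p a] in the crossing point [x], which satisfies
   [dot x n = dot (p k) n] *)
pose t : R := be / (al + be).
have albe : 0 < al + be := addr_gt0 al0 be0.
have t0 : 0 < t by rewrite divr_gt0.
have t1 : t < 1 by rewrite ltr_pdivrMr// mul1r ltrDr.
pose x : 'cV[R]_2 := t *: p a + (1 - t) *: p b.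
(* the position of [x] along the line from [p k], where [s = 0], to [p l], where
   [s = 1] *)
pose s : R := dot (x - p k) (p l - p k) / dot (p l - p k) (p l - p k).
have xE : x = p k + s *: (p l - p k).
  apply/eqP; rewrite addrC -subr_eq; apply/eqP; apply: (dot_basis_eq v0).
    by rewrite dotZl /s divfK// gt_eqF.
  rewrite dotZl dotvJv mulr0 -/n dotBl /x dotDl !dotZl.
  have : al + be != 0 by rewrite gt_eqF.
  by rewrite /t /al /be => ?; field.
have xhull i : dot (p i) n = dot (p k) n ->
    convex_hull (p @` [set j | j != i]) x.
  move=> ik; apply: (convex_setP _).1 => //; [exact: convex_hullP| | |lra|lra].
  - by apply: others => //; left.
  - by apply: others => //; right.
have [s0|s0] := leP s 0.
  apply: (nvertex k Vk).
  have -> : p k = (1 - s)^-1 *: x + (1 - (1 - s)^-1) *: p l.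
    rewrite xE; apply: colvec2_eq; rewrite !mxE; field; lra.
  have s1 : 0 < 1 - s by lra.
  apply: (convex_setP _).1; [exact: convex_hullP|exact: xhull| | | ].
  - by apply: sub_convex_hull; exists l => //=; rewrite eq_sym.
  - by rewrite invr_ge0 ltW.
  - by rewrite invf_le1//; lra.
have [s1|s1] := leP 1 s.
  apply: (nvertex l Vl).
  have -> : p l = s^-1 *: x + (1 - s^-1) *: p k.
    rewrite xE; apply: colvec2_eq; rewrite !mxE; field; lra.
  apply: (convex_setP _).1; [exact: convex_hullP|exact: xhull| | | ].
  - by apply: sub_convex_hull; exists k.
  - by rewrite invr_ge0 ltW.
  - by rewrite invf_le1.
have ph j : hull p (p j) by apply: sub_convex_hull; exists j.
have : boundary (hull p) x.
  apply: Skl; exists (1 - s) => /=; first by apply/andP; split; lra.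
  by rewrite xE; apply: colvec2_eq; rewrite !mxE; ring.
move=> [_]; apply.
apply: (@cross_interior _ _ _ (p a - p b) (p l - p k) (1 - t) t (1 - s) s);
  rewrite ?subr_gt0//.
- exact: convex_hullP.
- by rewrite -/n dotBl gt_eqF// subr_gt0 (lt_trans bn an).
- by rewrite (_ : _ + _ = p a)//; apply: colvec2_eq; rewrite !mxE; ring.
- by rewrite (_ : _ - _ = p b)//; apply: colvec2_eq; rewrite !mxE; ring.
- by rewrite xE (_ : _ + _ = p l)//; apply: colvec2_eq; rewrite !mxE; ring.
- by rewrite xE (_ : _ - _ = p k)//; apply: colvec2_eq; rewrite !mxE; ring.
Qed.

End Faces.

(** * Deviation and width *)

Section Width.
Context {R : realType} {m : nat} (p : 'I_m -> 'cV[R]_2).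
Implicit Types (n d : 'cV[R]_2) (c : R) (i j k l a b : 'I_m).

Lemma maxdist_ge c n j : `|dot (p j) n - c| <= maxdist p c n.
Proof. exact: (le_bigmax _ (fun j => `|dot (p j) n - c|)). Qed.

(** The deviation is reached at one of the two ends of the projected interval. *)
Lemma maxdist_face c n a b : in_face p n a -> in_face p (- n) b ->
  maxdist p c n = Num.max (dot (p a) n - c) (c - dot (p b) n).
Proof.
move=> ha /in_face_oppP hb; apply/le_anti/andP; split; last first.
  rewrite ge_max; apply/andP; split.
  - exact: le_trans (ler_norm _) (maxdist_ge c n a).
  - by apply: le_trans (maxdist_ge c n b); rewrite distrC ler_norm.
apply/bigmax_leP; split=> [|j _].
  have hba := hb a; rewrite le_max.
  by case: (leP 0 (dot (p a) n - c)) => //= ?; lra.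
have := ha j; have := hb j; rewrite le_max.
have [jc|jc] := leP 0 (dot (p j) n - c) => hbj haj.
- by rewrite ger0_norm// lerD2r haj.
- by rewrite ltr0_norm// opprB lerD2l lerN2 hbj orbT.
Qed.

Lemma maxdistN c n : maxdist p (- c) (- n) = maxdist p c n.
Proof. by apply: eq_bigr => j _; rewrite dotNr -opprD normrN. Qed.

Lemma half_width_le c n a b : in_face p n a -> in_face p (- n) b ->
  (dot (p a) n - dot (p b) n) / 2 <= maxdist p c n.
Proof.
move=> ha hb; rewrite (maxdist_face c ha hb) le_max.
by case: (leP _ (dot (p a) n - c)) => //= ?; lra.
Qed.

Lemma maxdist_mid n a b : in_face p n a -> in_face p (- n) b ->
  maxdist p ((dot (p a) n + dot (p b) n) / 2) n
    = (dot (p a) n - dot (p b) n) / 2.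
Proof. by move=> ha hb; rewrite (maxdist_face _ ha hb) max_l; lra. Qed.

(** A supporting line sees the full width of the point set. *)
Lemma maxdist_end n a b : in_face p n a -> in_face p (- n) b ->
  maxdist p (dot (p a) n) n = dot (p a) n - dot (p b) n.
Proof.
move=> ha hb; rewrite (maxdist_face _ ha hb) subrr max_r// subr_ge0.
by move/in_face_oppP: hb; apply.
Qed.

(** Both exposed faces contain a vertex, so the vertices already realize the two ends
    of the projected interval. *)
Lemma maxdist_verticesE c n (i0 : 'I_m) : injective p -> n != 0 ->
  maxdist_vertices p c n = maxdist p c n.
Proof.
move=> pinj n0; apply/le_anti/andP; split.
  apply/bigmax_leP; split=> [|j _]; last exact: maxdist_ge.
  exact: bigmax_ge_id.
have [a ha Va] := exists_vertex_in_face i0 pinj n0.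
have nn0 : - n != 0 by rewrite oppr_eq0.
have [b hb Vb] := exists_vertex_in_face i0 pinj nn0.
have ge j : vertices p (p j) -> `|dot (p j) n - c| <= maxdist_vertices p c n.
  move=> Vj; apply: (le_bigmax_cond _ (fun j => `|dot (p j) n - c|)).
  exact/mem_set.
rewrite (maxdist_face c ha hb) ge_max; apply/andP; split.
- exact: le_trans (ler_norm _) (ge a Va).
- by apply: le_trans (ge b Vb); rewrite distrC ler_norm.
Qed.

(** The normalized rotation of [p l - p k] is [n] or [- n], and the sign disappears
    under the absolute value. *)
Lemma edge_widthE n k l : injective p -> unit_circle n -> k != l ->
  dot (p l - p k) n = 0 -> edge_width p k l = maxdist p (dot (p k) n) n.
Proof.
move=> pinj n1 kl ln; rewrite -(maxdist_verticesE _ k pinj (unit_neq0 n1)).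
have v0 : p l - p k != 0.
  by rewrite subr_eq0; apply: contra kl => /eqP/pinj->.
have e0 := enorm_gt0 v0.
have e0' : enorm (p l - p k) != 0 by rewrite gt_eqF.
apply: eq_bigr => j _; rewrite -dotBl.
by case: (normal_unit n1 ln) => ->; rewrite ?dotNr ?normrN dotZr normrM gtr0_norm//;
  rewrite mulrAC divff// mul1r.
Qed.

(** The width of the point set as one explicit maximum, which makes its continuity in
    the direction evident. *)
Definition spread n : R :=
  \big[Num.max/0]_(jk : 'I_m * 'I_m) `|dot (p jk.1 - p jk.2) n|.

Lemma spread_face n a b : in_face p n a -> in_face p (- n) b ->
  spread n = dot (p a) n - dot (p b) n.
Proof.
move=> ha /in_face_oppP hb; apply/le_anti/andP; split; last first.
  rewrite -dotBl; apply: le_trans (ler_norm _) _.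
  exact: (le_bigmax _ (fun jk => `|dot (p jk.1 - p jk.2) n|) (a, b)).
apply/bigmax_leP; split=> [|[j k] _ /=]; first by rewrite subr_ge0 ha.
have := ha j; have := ha k; have := hb j; have := hb k.
by rewrite dotBl ler_norml => h1 h2 h3 h4; apply/andP; split; lra.
Qed.

Lemma spreadN n : spread (- n) = spread n.
Proof. by apply: eq_bigr => jk _; rewrite dotNr normrN. Qed.

(** Since opposite directions have equal widths, only the closed upper half-circle
    matters. It is parametrized by the abscissa in the compact interval from [-1] to
    [1], where the extreme value theorem for real functions applies. *)
Lemma exists_spread_min :
  exists2 n0, unit_circle n0 & forall n, unit_circle n -> spread n0 <= spread n.
Proof.
pose u (x : R) : 'cV[R]_2 := \col_i (if i == 0 then x else Num.sqrt (1 - x ^+ 2)).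
have u0 x : u x 0 0 = x by rewrite mxE.
have u1 x : u x 1 0 = Num.sqrt (1 - x ^+ 2) by rewrite mxE.
have uP n : unit_circle n -> 0 <= n 1 0 -> n = u (n 0 0).
  move=> /unit_circleE; rewrite dotE -!expr2 => nn n1; apply: colvec2_eq => //.
  by rewrite u1 -nn addrAC subrr add0r sqrtr_sqr ger0_norm.
have cont : continuous (fun x => spread (u x)).
  apply: continuous_big => [|[j k] _].
    exact: max_continuous.
  have -> : (fun x => `|dot (p j - p k) (u x)|) = (fun x =>
      `|(p j - p k) 0 0 * x + (p j - p k) 1 0 * Num.sqrt (1 - x ^+ 2)|).
    by apply/funext => x; rewrite dotE u0 u1.
  move=> x; apply: cvg_norm; apply: cvgD.
    by apply: cvgM; [exact: cvg_cst|exact: cvg_id].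
  apply: cvgM; first exact: cvg_cst.
  apply: (@continuous_comp _ _ _ (fun x : R => 1 - x ^+ 2) Num.sqrt);
    last exact: sqrt_continuous.
  apply: cvgB; first exact: cvg_cst.
  exact: exprn_continuous.
have N11 : -1 <= 1 :> R by lra.
have [x0 + x0min] := EVT_min N11 (continuous_subspaceT cont).
rewrite in_itv /= => /andP[x0l x0r].
have x0u : unit_circle (u x0).
  apply/unit_circleE; rewrite dotE u0 u1 -!expr2 sqr_sqrtr; first by ring.
  rewrite subr_ge0; nra.
exists (u x0) => // n n1.
have main n' : unit_circle n' -> 0 <= n' 1 0 -> spread (u x0) <= spread n'.
  move=> n'1 n'0; rewrite (uP n' n'1 n'0); apply: x0min; rewrite in_itv /=.
  move/unit_circleE: n'1; rewrite dotE => nn; apply/andP; split; nra.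
have [n0|n0] := leP 0 (n 1 0); first exact: main.
rewrite -(spreadN n); apply: main; first exact: unit_circleN.
by rewrite mxE oppr_ge0 ltW.
Qed.

End Width.

(** * Optimal lines *)

Section Optimal.
Context {R : realType} {m : nat} (p : 'I_m -> 'cV[R]_2).
Implicit Types (n d : 'cV[R]_2) (c : R) (i j k l a b : 'I_m).

Lemma exists_optimal : (2 <= m)%N -> exists c n, optimal p c n.
Proof.
move=> m2; pose i0 : 'I_m := Ordinal (ltnW m2).
have [n n1 nmin] := exists_spread_min p.
have [a ha] := exists_in_face p i0 n; have [b hb] := exists_in_face p i0 (- n).
exists ((dot (p a) n + dot (p b) n) / 2), n; split=> // c' n' n'1.
have [a' ha'] := exists_in_face p i0 n'.
have [b' hb'] := exists_in_face p i0 (- n').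
rewrite (maxdist_mid ha hb); apply: le_trans (half_width_le c' ha' hb').
by rewrite ler_pM2r ?invr_gt0// -(spread_face ha hb) -(spread_face ha' hb') nmin.
Qed.

Lemma optimalN c n : optimal p c n -> optimal p (- c) (- n).
Proof.
case=> n1 nmin; split=> [|c' n' n'1].
- exact: unit_circleN.
- by rewrite maxdistN; exact: nmin.
Qed.

(** Any offset other than the midpoint is farther than half the width from one of the
    two supporting lines. *)
Lemma optimal_mid c n a b : optimal p c n ->
  in_face p n a -> in_face p (- n) b ->
  c = (dot (p a) n + dot (p b) n) / 2.
Proof.
move=> [n1 cmin] ha hb.
have := cmin ((dot (p a) n + dot (p b) n) / 2) n n1.
rewrite (maxdist_mid ha hb) (maxdist_face c ha hb) ge_max => /andP[h1 h2].
lra.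
Qed.

(** Finitely many strict inequalities survive a small perturbation. *)
Lemma exists_small_scale (f g : 'I_m -> R) : (forall j, 0 < f j) ->
  exists2 t, 0 < t & forall j, t * g j <= f j.
Proof.
move=> f0; pose S : R := \sum_j `|g j| / f j.
have S0 : 0 <= S by apply: sumr_ge0 => j _; rewrite divr_ge0// ltW.
(* [S] bounds every ratio [`|g j| / f j]; adding 1 keeps the denominator positive *)
exists (1 + S)^-1 => [|j]; first by rewrite invr_gt0; lra.
rewrite mulrC ler_pdivrMr; last by lra.
have : `|g j| / f j <= S.
  rewrite /S (bigD1 j)//= lerDl sumr_ge0// => i _.
  by rewrite divr_ge0// ltW.
rewrite ler_pdivrMr// => gS.
have := ler_norm (g j); have := f0 j; nra.
Qed.

(** Turn [n] to [n + t *: d] with [d] a unit vector perpendicular to [n], pointing to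
    the side where [dot (p a - p b) _] does not increase. For small [t] the points
    [p a] and [p b] remain extremal because the other points are strictly inside the
    strip. Normalizing divides by the square root of [1 + t ^+ 2], so a positive
    width would strictly decrease, against optimality. *)
Lemma singleton_faces_width0 c n a b : optimal p c n ->
  (forall j, j != a -> dot (p j) n < dot (p a) n) ->
  (forall j, j != b -> dot (p b) n < dot (p j) n) ->
  dot (p a) n = dot (p b) n.
Proof.
move=> opt ha hb; have [n1 cmin] := opt.
have nn := (unit_circleE n).1 n1.
have fa : in_face p n a by move=> j; have [->//|/ha/ltW] := eqVneq j a.
have fb : in_face p (- n) b.
  by apply/in_face_oppP => j; have [->//|/hb/ltW] := eqVneq j b.
have [d [nd dd abd]] : exists d, [/\ dot n d = 0, dot d d = 1 &
    dot (p a) d <= dot (p b) d].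
  have [h|h] := leP (dot (p a) (J *m n)) (dot (p b) (J *m n)).
    by exists (J *m n); rewrite dotvJv dotJJ.
  exists (- (J *m n)); rewrite !dotNr dotNl opprK dotvJv oppr0 dotJJ nn.
  by split=> //; rewrite lerN2 ltW.
(* margins by which [p j] stays clear of the two supporting lines; the value 1 at the
   contact points only keeps the families positive *)
pose fA j := if j == a then 1 else dot (p a) n - dot (p j) n.
pose fB j := if j == b then 1 else dot (p j) n - dot (p b) n.
have fA0 j : 0 < fA j.
  by rewrite /fA; case: eqVneq => // /ha; rewrite subr_gt0.
have fB0 j : 0 < fB j.
  by rewrite /fB; case: eqVneq => // /hb; rewrite subr_gt0.
have f0 j : 0 < Num.min (fA j) (fB j) by rewrite lt_min fA0 fB0.
have [t t0 ht] := exists_small_scale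
  (fun j => `|dot (p j) d - dot (p a) d| + `|dot (p b) d - dot (p j) d|) f0.
pose nt := n + t *: d.
have fat : in_face p nt a.
  move=> j; rewrite !dotDr !dotZr; have [->//|ja] := eqVneq j a.
  have : t * (dot (p j) d - dot (p a) d) <= fA j.
    apply: le_trans (_ : t * _ <= _) (le_trans (ht j) _); last first.
      by rewrite ge_min lexx.
    by rewrite ler_pM2l// (le_trans (ler_norm _))// lerDl.
  by rewrite /fA (negbTE ja); lra.
have fbt : in_face p (- nt) b.
  apply/in_face_oppP => j; rewrite !dotDr !dotZr; have [->//|jb] := eqVneq j b.
  have : t * (dot (p b) d - dot (p j) d) <= fB j.
    apply: le_trans (_ : t * _ <= _) (le_trans (ht j) _); last first.
      by rewrite ge_min lexx orbT.
    by rewrite ler_pM2l// (le_trans (ler_norm _))// lerDr.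
  by rewrite /fB (negbTE jb); lra.
have ntnt : dot nt nt = 1 + t ^+ 2.
  rewrite dotDl !dotDr !dotZl !dotZr nn dd (dotC d n) nd; ring.
have nt0 : nt != 0.
  by rewrite -dotvv_eq0 ntnt gt_eqF// ltr_wpDr ?sqr_ge0.
pose N : R := enorm nt.
have N0 : 0 < N := enorm_gt0 nt0.
have N1 : 1 < N.
  rewrite -(@ltr_pXn2r _ 2) ?nnegrE ?ltW// expr1n.
  by rewrite sqr_sqrtr ?dotvv_ge0// ntnt ltrDl exprn_gt0.
have iN0 : 0 < N^-1 by rewrite invr_gt0.
have fa' : in_face p (N^-1 *: nt) a by apply/in_faceZ.
have fb' : in_face p (- (N^-1 *: nt)) b by rewrite -scalerN; apply/in_faceZ.
have := cmin _ _ (unit_normalize nt0).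
move=> /(_ ((dot (p a) (N^-1 *: nt) + dot (p b) (N^-1 *: nt)) / 2)).
rewrite (maxdist_mid fa' fb') => /(le_trans (half_width_le c fa fb)).
rewrite ler_pM2r ?invr_gt0// !dotZr -mulrBr mulrC ler_pdivlMr// /nt.
rewrite !dotDr !dotZr => W.
have Wge : dot (p b) n <= dot (p a) n by apply: fa.
apply/eqP; rewrite eq_le Wge andbT.
have : t * dot (p a) d <= t * dot (p b) d by rewrite ler_pM2l.
nra.
Qed.

(** When the width vanishes, all points lie on one line and any two of them do;
    otherwise [singleton_faces_width0] excludes that both faces are single points. *)
Lemma optimal_face c n : (2 <= m)%N -> optimal p c n ->
  exists k l, k != l /\
    (in_face p n k /\ in_face p n l \/ in_face p (- n) k /\ in_face p (- n) l).
Proof.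
move=> m2 opt; apply: contrapT => none.
pose i0 : 'I_m := Ordinal (ltnW m2); pose i1 : 'I_m := Ordinal m2.
have [a ha] := exists_in_face p i0 n; have [b hb] := exists_in_face p i0 (- n).
have hb' := (in_face_oppP p n b).1 hb.
have sa j : j != a -> dot (p j) n < dot (p a) n.
  move=> ja; rewrite lt_neqAle ha andbT; apply/eqP => e.
  apply: none; exists j, a; split=> //; left; split=> //.
  exact: in_face_transfer e.
have sb j : j != b -> dot (p b) n < dot (p j) n.
  move=> jb; rewrite lt_neqAle hb' andbT; apply/eqP => e.
  apply: none; exists j, b; split=> //; right; split=> //.
  by apply: (in_face_transfer hb); rewrite !dotNr e.
have ab := singleton_faces_width0 opt sa sb.
apply: none; exists i0, i1; split=> //; left.
have all j : in_face p n j.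
  by apply: (in_face_transfer ha); apply/eqP; rewrite eq_le ha ab hb'.
by split.
Qed.

(** The pairs [(c, n)] and [(- c, - n)] describe the same line; choosing between them
    puts the edge on the face exposed by the normal itself. *)
Lemma optimal_edge c n : (2 <= m)%N -> injective p -> optimal p c n ->
  exists c' n', [/\ (c', n') = (c, n) \/ (c', n') = (- c, - n),
    optimal p c' n' &
    exists k l, [/\ boundary_edge p k l, in_face p n' k & in_face p n' l]].
Proof.
move=> m2 pinj opt.
have edge n' k l : unit_circle n' -> k != l -> in_face p n' k ->
    in_face p n' l ->
    exists k l, [/\ boundary_edge p k l, in_face p n' k & in_face p n' l].
  move=> n1 kl hk hl; have n0 := unit_neq0 n1.
  have [k' [l' [kl' [hk' hl'] Vk Vl]]] :=
    exists_vertices_in_face pinj n0 kl hk hl.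
  by exists k', l'; split=> //; split=> //; apply: face_segment_boundary hk' hl'.
have [k [l [kl [[hk hl]|[hk hl]]]]] := optimal_face m2 opt.
- exists c, n; split=> //; [by left|exact: edge (opt.1) kl hk hl].
- exists (- c), (- n); have optN := optimalN opt.
  split=> //; [by right|exact: edge (optN.1) kl hk hl].
Qed.

(** As the offset is the midpoint, both supporting lines are at distance
    [maxdist p c n]; one carries an edge and the other at least one vertex. *)
Lemma optimal_three c n : (2 <= m)%N -> injective p -> optimal p c n ->
  0 < maxdist p c n -> exists k1 k2 k3 : 'I_m,
  [/\ [/\ k1 != k2, k1 != k3 & k2 != k3],
     [/\ vertices p (p k1), vertices p (p k2) & vertices p (p k3)],
     [/\ maxdist p c n = `|dot (p k1) n - c|,
         maxdist p c n = `|dot (p k2) n - c| &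
         maxdist p c n = `|dot (p k3) n - c|] &
     segment p k1 k2 `<=` boundary (hull p)].
Proof.
move=> m2 pinj opt pos.
have [c' [n' [cnE opt' [k [l [[kl Vk Vl Skl] hk hl]]]]]] := optimal_edge m2 pinj opt.
have dE j : `|dot (p j) n' - c'| = `|dot (p j) n - c|.
  by case: cnE => -[-> ->] //; rewrite dotNr -opprD normrN.
have mE : maxdist p c' n' = maxdist p c n.
  by case: cnE => -[-> ->] //; rewrite maxdistN.
have nn0 : - n' != 0 by rewrite oppr_eq0; exact: unit_neq0 opt'.1.
have [b hb Vb] := exists_vertex_in_face k pinj nn0.
have W := maxdist_mid hk hb; rewrite -(optimal_mid opt' hk hb) mE in W.
have cE := optimal_mid opt' hk hb.
have kleq := in_face_eq hk hl.
have neq j : dot (p j) n' = dot (p k) n' -> j != b.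
  by move=> jk; apply/eqP => jb; move: pos; rewrite W -jb jk subrr mul0r ltxx.
exists k, l, b; split=> //.
  by split=> //; apply: neq.
have kc : dot (p k) n' - c' = maxdist p c n by rewrite W cE; lra.
have bc : dot (p b) n' - c' = - maxdist p c n by rewrite W cE; lra.
by rewrite -!dE -kleq bc kc normrN gtr0_norm.
Qed.

(** The line through a boundary edge supports the hull, so the deviation from it is
    the width in the normal direction, twice the deviation of the middle line. *)
Lemma edge_width_ge c n k l : injective p -> optimal p c n ->
  boundary_edge p k l -> 2 * maxdist p c n <= edge_width p k l.
Proof.
move=> pinj [n1 cmin] kledge; have [kl _ _ _] := kledge.
have v0 : J *m (p l - p k) != 0.
  by rewrite J_eq0 subr_eq0; apply: contra kl => /eqP/pinj->.
pose nu := (enorm (J *m (p l - p k)))^-1 *: (J *m (p l - p k)).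
have nu1 : unit_circle nu := unit_normalize v0.
have nuE : dot (p l - p k) nu = 0 by rewrite dotZr dotvJv mulr0.
have i0 : 0 < (enorm (J *m (p l - p k)))^-1 by rewrite invr_gt0 enorm_gt0.
have main n' : unit_circle n' -> in_face p n' k ->
    2 * maxdist p c n <= maxdist p (dot (p k) n') n'.
  move=> n'1 hk; have [b hb] := exists_in_face p k (- n').
  rewrite (maxdist_end hk hb).
  have := cmin ((dot (p k) n' + dot (p b) n') / 2) n' n'1.
  rewrite (maxdist_mid hk hb); lra.
rewrite (edge_widthE pinj nu1 kl nuE).
case: (boundary_edge_one_sided pinj kledge) => hk.
- by apply: main => //; apply/in_faceZ.
- rewrite -(maxdistN p _ nu) -dotNr; apply: main; first exact: unit_circleN.
  by rewrite -scalerN; apply/in_faceZ.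
Qed.

(** Equality in [edge_width_ge] holds for the edge on a supporting line of the optimal
    direction. *)
Lemma optimal_edge_width c n : (2 <= m)%N -> injective p -> optimal p c n ->
  exists k l, boundary_edge p k l /\ edge_width p k l = 2 * maxdist p c n.
Proof.
move=> m2 pinj opt.
have [c' [n' [cnE opt' [k [l [kledge hk hl]]]]]] := optimal_edge m2 pinj opt.
exists k, l; split=> //.
have [b hb] := exists_in_face p k (- n').
have mE : maxdist p c' n' = maxdist p c n.
  by case: cnE => -[-> ->] //; rewrite maxdistN.
have [kl _ _ _] := kledge.
rewrite (edge_widthE pinj opt'.1 kl).
  rewrite (maxdist_end hk hb) -mE (optimal_mid opt' hk hb) (maxdist_mid hk hb).
  lra.
by rewrite dotBl (in_face_eq hk hl) subrr.
Qed.

Definition unit_normal k l : 'cV[R]_2 :=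
  (enorm (p l - p k))^-1 *: (J *m (p l - p k)).

(** An optimal line is determined by an ordered pair of points giving its normal and
    a pair of extremal points giving its offset. *)
Lemma finite_optimal_lines : (2 <= m)%N -> injective p ->
  finite_set (optimal_lines p).
Proof.
move=> m2 pinj.
pose L (x : 'I_m * 'I_m * ('I_m * 'I_m)) : set 'cV[R]_2 :=
  let n := unit_normal x.1.1 x.1.2 in
  line ((dot (p x.2.1) n + dot (p x.2.2) n) / 2) n.
apply: (@sub_finite_set _ _ (L @` setT)); last first.
  exact: finite_image (finite_finset).
move=> _ [c [n [opt ->]]].
have [k [l [kl hkl]]] := optimal_face m2 opt.
have ln : dot (p l - p k) n = 0.
  rewrite dotBl; apply/eqP; rewrite subr_eq0; apply/eqP; symmetry.
  case: hkl => -[hk hl]; first exact: in_face_eq.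
  by have := in_face_eq hk hl; rewrite !dotNr => /oppr_inj.
have v0 : p l - p k != 0.
  by rewrite subr_eq0; apply: contra kl => /eqP/pinj->.
have e0 : enorm (p l - p k) != 0 by rewrite gt_eqF ?enorm_gt0.
have [k' [l' nE]] : exists k' l', n = unit_normal k' l'.
  have [h|h] := normal_unit opt.1 ln.
    by exists k, l; rewrite /unit_normal h scalerA mulVf// scale1r.
  exists l, k; rewrite /unit_normal -(opprB (p l)) mulmxN h opprK.
  rewrite scalerA (_ : enorm (- _) = enorm (p l - p k)) ?mulVf ?scale1r//.
  by rewrite /enorm dotNl dotNr opprK.
have [a ha] := exists_in_face p k n; have [b hb] := exists_in_face p k (- n).
exists (k', l', (a, b)) => //; rewrite /L /= -nE.
by rewrite (optimal_mid opt ha hb).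
Qed.

End Optimal.

Theorem theorem7 (R : realType) (m : nat) (p : 'I_m -> 'cV[R]_2)
    (hm : (2 <= m)%N) (hp : injective p) :
  [/\ optimal_lines p !=set0,
      (forall (c0 : R) (n0 : 'cV[R]_2),
         optimal p c0 n0 -> 0 < maxdist p c0 n0 ->
         exists k1 k2 k3 : 'I_m,
           [/\ [/\ k1 != k2, k1 != k3 & k2 != k3],
               [/\ vertices p (p k1), vertices p (p k2) & vertices p (p k3)],
               [/\ maxdist p c0 n0 = `|dot (p k1) n0 - c0|,
                   maxdist p c0 n0 = `|dot (p k2) n0 - c0| &
                   maxdist p c0 n0 = `|dot (p k3) n0 - c0|] &
               segment p k1 k2 `<=` boundary (hull p)]),
      (exists mu nu : R,
         [/\ is_minimum
               [set maxdist p cn.1 cn.2 | cn in [set: R] `*` unit_circle] mu,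
             is_minimum
               [set maxdist_vertices p cn.1 cn.2
                  | cn in [set: R] `*` unit_circle] mu,
             is_minimum
               [set edge_width p kl.1 kl.2
                  | kl in [set kl | boundary_edge p kl.1 kl.2]] nu &
             mu = 2^-1 * nu]) &
      finite_set (optimal_lines p)].
Proof.
have [c [n opt]] := exists_optimal p hm; have [n1 cmin] := opt.
have vE c' n' : unit_circle n' -> maxdist_vertices p c' n' = maxdist p c' n'.
  by move=> n'1; apply: (maxdist_verticesE _ (Ordinal hm)) => //; exact: unit_neq0.
have [k [l [kledge klw]]] := optimal_edge_width hm hp opt.
split.
- by exists (line c n), c, n.
- by move=> c0 n0; apply: optimal_three.
- exists (maxdist p c n), (2 * maxdist p c n); split.
  + split; first by exists (c, n).
    by move=> _ [[c' n'] [_ n'1] <-]; apply: cmin.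
  + split; first by exists (c, n) => //=; rewrite vE.
    by move=> _ [[c' n'] [_ n'1] <-] /=; rewrite vE//; apply: cmin.
  + split; first by exists (k, l).
    by move=> _ [[k' l'] kl' <-]; apply: edge_width_ge.
  + by rewrite mulKf// pnatr_eq0.
- exact: finite_optimal_lines.
Qed.
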